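(* Let $d\ge 2$ be an integer. Every $d$-ary tree $D$ with at least two leaves satisfies $$i_d(D)\ \ge\ \frac{(|D|-1)!}{|D|^{|D|-1}-1}.$$ In particular, every $d$-ary tree with at least two leaves has positive inducibility, i.e. $i_d(D)>0$.
   Context: All trees are finite and rooted, with unordered children; isomorphism means isomorphism of rooted trees. The single vertex is regarded as a tree whose only vertex is both root and leaf. For a rooted tree $T$, $|T|$ denotes its number of leaves. For an integer $d\ge 2$, a $d$-ary tree is a rooted tree in which every non-leaf vertex has between $2$ and $d$ children; it is strictly $d$-ary if every non-leaf vertex has exactly $d$ children. (An $n$-leaf strictly $d$-ary tree exists iff $n\ge 1$ and $n\equiv 1 \bmod (d-1)$.) For a nonempty set $S$ of leaves of $T$, the subtree of $T$ induced by $S$ is obtained by taking the minimal subtree of $T$ containing the leaves in $S$, rooting it at the most recent common ancestor of $S$, and suppressing (contracting) all non-root vertices of degree $2$. Let $c(D,T)$ be the number of sets of $|D|$ leaves of $T$ whose induced subtree is isomorphic to $D$, and for $|T|\ge |D|$ let $\gamma(D,T)=c(D,T)/\binom{|T|}{|D|}$. The inducibility of a $d$-ary tree $D$ in strictly $d$-ary trees is $$i_d(D)=\limsup_{n\to\infty}\ \max_{|T|=n,\ T\text{ strictly }d\text{-ary}}\gamma(D,T),$$ where $n$ ranges over integers $n\equiv 1 \bmod (d-1)$. *)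

(* Defs.v *)
From HB Require Import structures.
From mathcomp Require Import all_boot all_order all_algebra.
From mathcomp Require Import all_classical all_reals all_analysis.

Set Implicit Arguments.
Unset Strict Implicit.
Unset Printing Implicit Defensive.
Import Order.TTheory GRing.Theory Num.Theory.

(* A finite rooted tree is given by the list of the branches at its root.  The
   order of the branches is immaterial: trees are compared with [tree_iso].   *)
Inductive tree : Type := Node of seq tree.

Fixpoint tree_encode (t : tree) : GenTree.tree void :=
  let: Node ts := t in GenTree.Node 0 [seq tree_encode u | u <- ts].

Fixpoint tree_decode (g : GenTree.tree void) : tree :=
  match g with
  | GenTree.Leaf _ => Node [::]
  | GenTree.Node _ gs => Node [seq tree_decode h | h <- gs]
  end.

Lemma tree_encodeK : cancel tree_encode tree_decode.
Proof.
rewrite /cancel; fix IH 1; case=> ts /=; congr Node.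
by elim: ts => [|u ts IHts] //=; rewrite IH IHts.
Qed.

HB.instance Definition _ := Countable.copy tree (can_type tree_encodeK).

(* Isomorphism of rooted trees with unordered children: the branches can be
   matched bijectively with pairwise isomorphic ones.                         *)
Fixpoint tree_iso (t u : tree) : bool :=
  let: Node ts := t in let: Node us := u in
  has (fun vs => all2 tree_iso ts vs) (permutations us).

(* [imap_from k f [:: x0; x1; x2; ...]] is [:: f k x0; f k.+1 x1; ...].       *)
Section IndexedMap.
Variables (A B : Type) (f : nat -> A -> B).
Fixpoint imap_from (k : nat) (s : seq A) : seq B :=
  if s is x :: s' then f k x :: imap_from k.+1 s' else [::].
Definition imap (s : seq A) : seq B := imap_from 0 s.
End IndexedMap.

(* A vertex is named by its address, the sequence of branch numbers followed
   from the root to reach it; [leaves t] lists the addresses of the leaves.   *)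
Fixpoint leaves (t : tree) : seq (seq nat) :=
  let: Node ts := t in
  if nilp ts then [:: [::]]
  else flatten (imap (fun i u => [seq i :: p | p <- leaves u]) ts).

Definition nleaves (t : tree) : nat := size (leaves t).

Fixpoint dary (d : nat) (t : tree) : bool :=
  let: Node ts := t in
  (nilp ts || (2 <= size ts <= d)) && all (dary d) ts.

Fixpoint strictly_dary (d : nat) (t : tree) : bool :=
  let: Node ts := t in
  (nilp ts || (size ts == d)) && all (strictly_dary d) ts.

(* The subtree formed by the paths from the root to the leaves in [S].        *)
Fixpoint prune (S : pred (seq nat)) (t : tree) : tree :=
  let: Node ts := t in
  Node (pmap id (imap (fun i u =>
    let Si := fun p => S (i :: p) in
    if has Si (leaves u) then Some (prune Si u) else None) ts)).

(* In a pruned tree, the most recent common ancestor of the leaves is the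
   first vertex, going down from the root, without exactly one child.         *)
Fixpoint root_at_mrca (t : tree) : tree :=
  match t with
  | Node [:: u] => root_at_mrca u
  | _ => t
  end.

Fixpoint contract_unary (t : tree) : tree :=
  match t with
  | Node [:: u] => contract_unary u
  | Node ts => Node [seq contract_unary u | u <- ts]
  end.

(* A non-root vertex has degree 2 iff it has exactly one child.               *)
Definition suppress_nonroot (t : tree) : tree :=
  let: Node ts := t in Node [seq contract_unary u | u <- ts].

Definition induced (t : tree) (S : {set seq_sub (leaves t)}) : tree :=
  suppress_nonroot (root_at_mrca (prune (mem [seq val l | l <- enum S]) t)).

Definition copies (D T : tree) : nat :=
  #|[set S : {set seq_sub (leaves T)} |
      (#|S| == nleaves D) && tree_iso (induced S) D]|.

Local Open Scope classical_set_scope.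
Local Open Scope ring_scope.

(* Only meaningful for [nleaves D <= nleaves T]; it is 0 otherwise.           *)
Definition density (R : realType) (D T : tree) : R :=
  (copies D T)%:R / 'C(nleaves T, nleaves D)%:R.

(* For [2 <= d] and [n = 1 %[mod d.-1]], [0 < n], the set of densities is
   finite and nonempty, so that its supremum is a maximum.                    *)
Definition max_density (R : realType) (d : nat) (D : tree) (n : nat) : \bar R :=
  ereal_sup [set (density R D T)%:E |
    T in [set T : tree | strictly_dary d T /\ nleaves T = n]].

Definition inducibility (R : realType) (d : nat) (D : tree) : \bar R :=
  limf_esup (max_density R d D)
    (within [set n : nat | (n = 1 %[mod d.-1])%N] \oo).

(* Main.v *)
(* Let [k = nleaves D].  Pad [D] with leaves so that every non-leaf vertex has
   [d] children, and put a copy of a strictly [d]-ary tree [U] at each of the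
   [k] original leaves.  One leaf from each of the [k] copies of [U] induces
   [D], and so does a copy of [D] inside one copy of [U]; iterating from the
   single vertex, the numbers [n j] of leaves and [c j] of copies of [D] satisfy
   [n (j+1) = k * n j + e] and [c (j+1) >= n j ^ k + k * c j], so that
   [c j / n j ^ k] is asymptotically at least the solution
   [x = 1 / (k ^ k - k)] of [k ^ k * x = 1 + k * x].                          *)
Require Import Defs.
From mathcomp Require Import all_boot all_order all_algebra.
From mathcomp Require Import all_classical all_reals all_analysis.
From mathcomp Require Import ring lra zify.

Set Implicit Arguments.
Unset Strict Implicit.
Unset Printing Implicit Defensive.
Import Order.TTheory GRing.Theory Num.Theory.

(** * Rooted trees, their leaves and induced subtrees *)

Local Notation leaf := (Node [::]).

(** The branches sit inside a [seq], so the induction hypothesis ranges over all members of that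
    list. *)
Lemma tree_seq_ind (P : tree -> Prop) :
  (forall ts, {in ts, forall t, P t} -> P (Node ts)) -> forall t, P t.
Proof.
move=> PN; fix IH 1; case=> ts; apply: PN.
elim: ts => [|t ts IHts] u; first by rewrite in_nil => /notF[].
rewrite in_cons => /predU1P[->|]; [exact: IH | exact: IHts].
Qed.

Lemma tree_iso_refl : reflexive tree_iso.
Proof.
elim/tree_seq_ind => ts IH /=; apply/hasP; exists ts.
  by rewrite mem_permutations.
elim: ts IH => //= t ts IHts IH; rewrite IH ?mem_head //=.
by apply: IHts => u uts; apply: IH; rewrite in_cons uts orbT.
Qed.

Lemma imapE (A B : Type) (x0 : A) (f : nat -> A -> B) (s : seq A) :
  imap f s = [seq f i (nth x0 s i) | i <- iota 0 (size s)].
Proof.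
suff H k : imap_from f k s =
    [seq f (k + i) (nth x0 s i) | i <- iota 0 (size s)].
  by rewrite /imap H.
elim: s k => //= x s IHs k; rewrite addn0 IHs (iotaDl 1 0) -map_comp.
by congr cons; apply: eq_map => i /=; rewrite addSnnS.
Qed.

Lemma leaves_Node ts : leaves (Node ts) =
  if nilp ts then [:: [::]]
  else [seq i :: p | i <- iota 0 (size ts), p <- leaves (nth leaf ts i)].
Proof. by rewrite /=; case: ifP => // _; rewrite (imapE leaf). Qed.

Lemma mem_leaves_Node ts x : ~~ nilp ts -> (x \in leaves (Node ts)) =
  if x is i :: p then (i < size ts) && (p \in leaves (nth leaf ts i))
  else false.
Proof.
rewrite leaves_Node => /negPf->; apply/allpairsPdep/idP.
  by move=> [i [p []]]; rewrite mem_iota /= add0n => its pi ->; rewrite its.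
by case: x => // i p /andP[? ?]; exists i, p; rewrite mem_iota /= add0n.
Qed.

Lemma uniq_leaves t : uniq (leaves t).
Proof.
elim/tree_seq_ind: t => ts IH; rewrite leaves_Node; case: ifP => // _.
apply: allpairs_uniq_dep; first exact: iota_uniq.
  by move=> i; rewrite mem_iota add0n => /(mem_nth leaf)/IH.
by move=> [i p] [j q] _ _ /= [-> ->].
Qed.

Lemma nleaves_Node ts :
  nleaves (Node ts) = if nilp ts then 1 else sumn [seq nleaves t | t <- ts].
Proof.
rewrite /nleaves leaves_Node; case: ifP => // _; rewrite size_allpairs_dep.
by rewrite -[in RHS](mkseq_nth leaf ts) -map_comp.
Qed.

Lemma prune_Node S ts : prune S (Node ts) =
  Node [seq prune (S \o cons i) (nth leaf ts i)
       | i <- iota 0 (size ts) & has (S \o cons i) (leaves (nth leaf ts i))].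
Proof.
rewrite /= (imapE leaf); congr Node.
by elim: (iota _ _) => //= i s ->; rewrite /comp; case: ifP.
Qed.

(** Descending to the most recent common ancestor only skips vertices with a single child, which
    [contract_unary] skips as well; one contraction from the root does both steps. *)
Lemma inducedE T (S : {set seq_sub (leaves T)}) :
  Defs.induced S = contract_unary (prune (mem [seq val l | l <- enum S]) T).
Proof.
by rewrite /Defs.induced; move: (prune _ _); fix IH 1; case=> [[|t [|u s]]] //=.
Qed.

Lemma contract_unary_Node ts : size ts != 1 ->
  contract_unary (Node ts) = Node [seq contract_unary t | t <- ts].
Proof. by case: ts => [|t [|]]. Qed.

(** * Grafting a tree at the leaves of [D] *)

(* The padding comes after the branches of [t], so that the address of each
   original leaf of [t] becomes the address of the root of a copy of [U].     *)
Fixpoint graft (d : nat) (U t : tree) : tree :=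
  let: Node ts := t in
  if nilp ts then U
  else Node ([seq graft d U u | u <- ts] ++ nseq (d - size ts) leaf).

(** The constant [e] of the recurrence [n (j+1) = k * n j + e]: the number of padding leaves, the
    same for every [U]. *)
Fixpoint missing_children (d : nat) (t : tree) : nat :=
  let: Node ts := t in
  if nilp ts then 0
  else sumn [seq missing_children d u | u <- ts] + (d - size ts).

Lemma graft_Node d U ts : ~~ nilp ts -> graft d U (Node ts) =
  Node ([seq graft d U u | u <- ts] ++ nseq (d - size ts) leaf).
Proof. by move=> /= /negPf->. Qed.

Lemma strictly_dary_graft d U D :
  strictly_dary d U -> dary d D -> strictly_dary d (graft d U D).
Proof.
move=> dU; elim/tree_seq_ind: D => ts IH /=; case: ifP => //= ts0.
move=> /andP[/andP[_ led] /allP dts].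
rewrite size_cat size_map size_nseq subnKC // eqxx orbT /= all_cat.
rewrite all_nseq orbT andbT; apply/allP => _ /mapP[t tts ->].
exact: IH (dts _ tts).
Qed.

Lemma nleaves_graft d U D :
  nleaves (graft d U D) = nleaves D * nleaves U + missing_children d D.
Proof.
elim/tree_seq_ind: D => ts IH; rewrite [nleaves (Node ts)]nleaves_Node.
case: (boolP (nilp ts)) => [/nilP->|ts0]; first by rewrite /= mul1n addn0.
rewrite graft_Node // nleaves_Node /= (negPf ts0).
rewrite /nilp size_cat size_map addn_eq0.
rewrite -[size ts == 0]/(nilp ts) (negPf ts0) /=.
rewrite map_cat sumn_cat map_nseq sumn_nseq mul1n addnA; congr (_ + _).
elim: ts IH {ts0} => //= t ts IHts IH; rewrite IH ?mem_head // IHts.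
  by rewrite mulnDl addnACA.
by move=> u uts; apply: IH; rewrite in_cons uts orbT.
Qed.

(** By induction each of the [d] branches contributes 1 modulo [d - 1], and [d] is itself congruent
    to 1. *)
Lemma nleaves_strictly_dary_mod d t :
  2 <= d -> strictly_dary d t -> nleaves t = 1 %[mod d.-1].
Proof.
move=> d2; elim/tree_seq_ind: t => ts IH; rewrite nleaves_Node /=.
case: ifP => //= _ /andP[/eqP sts /allP dts].
have -> : sumn [seq nleaves t | t <- ts] = size ts %[mod d.-1].
  elim: ts IH dts {sts} => //= t ts IHts IH dts.
  rewrite -modnDm IH ?mem_head ?dts ?mem_head // IHts ?modnDm //.
  - by move=> u uts; apply: IH; rewrite in_cons uts orbT.
  - by move=> u uts; apply: dts; rewrite in_cons uts orbT.
by rewrite sts -{1}(prednK (ltnW d2)) -addn1 modnDl.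
Qed.

(** * Leaves and induced subtrees of the grafted tree *)

Lemma nth_graft d U ts i : i < size ts ->
  nth leaf ([seq graft d U u | u <- ts] ++ nseq (d - size ts) leaf) i
  = graft d U (nth leaf ts i).
Proof. by move=> its; rewrite nth_cat size_map its (nth_map leaf). Qed.

Lemma mem_leaves_graft d U D p q :
  p \in leaves D -> q \in leaves U -> p ++ q \in leaves (graft d U D).
Proof.
elim/tree_seq_ind: D p => ts IH p.
case: (boolP (nilp ts)) => [/nilP->|ts0]; first by rewrite inE => /eqP->.
rewrite graft_Node // mem_leaves_Node // => + qU.
case: p => // i p /andP[its pts]; rewrite cat_cons mem_leaves_Node; last first.
  by rewrite /nilp size_cat size_map addn_eq0 negb_and ts0.
rewrite size_cat size_map ltn_addr //= nth_graft //.
by apply: IH => //; apply: mem_nth.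
Qed.

(** No leaf address is a proper prefix of another. *)
Lemma leaves_cat_inj D p p' q q' : p \in leaves D -> p' \in leaves D ->
  p ++ q = p' ++ q' -> p = p' /\ q = q'.
Proof.
elim/tree_seq_ind: D p p' => ts IH p p'.
case: (boolP (nilp ts)) => [/nilP->|ts0].
  by rewrite !inE => /eqP-> /eqP->.
rewrite !mem_leaves_Node //; case: p p' => // i p [] // i' p'.
move=> /andP[its pi] /andP[_ pi'] [ii' eqpq]; rewrite -ii' in pi' *.
by have [-> ->] := IH _ (mem_nth leaf its) _ _ pi pi' eqpq.
Qed.

Lemma leaves_neq0 t : leaves t != [::].
Proof.
elim/tree_seq_ind: t => -[//|t ts] IH; have := IH t (mem_head _ _).
case E: (leaves t) => [//|p s] _; apply/eqP => E'.
have : 0 :: p \in leaves (Node (t :: ts)).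
  by rewrite mem_leaves_Node //= E mem_head.
by rewrite E'.
Qed.

(** Applied to the indices of the branches that meet a leaf set: pruning keeps branch [i] alone. *)
Lemma filter_iota_eq (a : pred nat) n i : i < n ->
  {in gtn n, a =1 pred1 i} -> [seq j <- iota 0 n | a j] = [:: i].
Proof.
move=> ltin ai; rewrite (_ : [seq j <- _ | _] = [seq j <- iota 0 n | j == i]).
  by rewrite filter_pred1_uniq ?iota_uniq // mem_iota.
by apply: eq_in_filter => j; rewrite mem_iota add0n => /ai.
Qed.

(** Pruning to one leaf leaves a path, which contracts to a single vertex. *)
Lemma contract_prune_single t q S : q \in leaves t -> S =1 pred1 q ->
  contract_unary (prune S t) = leaf.
Proof.
elim/tree_seq_ind: t q S => ts IH q S.
case: (boolP (nilp ts)) => [/nilP-> //|ts0].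
rewrite mem_leaves_Node //; case: q => // i q /andP[its qi] Sq.
rewrite prune_Node (@filter_iota_eq _ _ i) //=; last first.
  move=> j jts /=; apply/hasP/eqP => [[x _] /=|->].
    by rewrite Sq => /eqP[].
  by exists q; rewrite //= Sq /=.
apply: (IH _ (mem_nth leaf its) q) => // x.
by rewrite /= Sq /= eqseq_cons eqxx.
Qed.

(** Outside the copy of [U] at [p] only the path from the root to [p] survives pruning, and
    contraction removes it. A nonempty selection keeps that path from being pruned. *)
Lemma contract_prune_below d U D p (S : pred (seq nat)) : p \in leaves D ->
    (forall x, S x -> exists q, x = p ++ q) -> has (S \o cat p) (leaves U) ->
  contract_unary (prune S (graft d U D)) =
  contract_unary (prune (S \o cat p) U).
Proof.
elim/tree_seq_ind: D p S => ts IH p S.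
case: (boolP (nilp ts)) => [/nilP->|ts0].
  by rewrite inE => /eqP->.
rewrite graft_Node // mem_leaves_Node //.
case: p => // i p /andP[its pi] Sp hasS.
rewrite prune_Node size_cat size_map.
rewrite (@filter_iota_eq _ _ i) ?ltn_addr //=; last first.
  move=> j _ /=; apply/hasP/eqP => [[x _] /= /Sp[q [->//]]|->].
  have /hasP[q qU Sq] := hasS; exists (p ++ q) => //.
  by rewrite nth_graft // mem_leaves_graft.
rewrite nth_graft // (IH _ (mem_nth leaf its) p (S \o cons i)) //.
by move=> x /= /Sp[q [->]]; exists q.
Qed.

(** With one leaf chosen in each copy of [U], every copy shrinks to a leaf and the padding
    disappears. Each inner vertex of [D] keeps all its branches, at least two, so contraction spares
    it. The order of branches is kept too, whence an equality. *)
Lemma contract_prune_transversal d U D f (S : pred (seq nat)) :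
    dary d D -> {in leaves D, forall p, f p \in leaves U} ->
    S =1 mem [seq p ++ f p | p <- leaves D] ->
  contract_unary (prune S (graft d U D)) = D.
Proof.
elim/tree_seq_ind: D f S => ts IH f S dD fU ES.
case: (boolP (nilp ts)) dD fU ES => [/nilP-> _ fU ES|ts0].
  apply: (@contract_prune_single _ (f [::])); first exact/fU/mem_head.
  by move=> x; rewrite ES /= inE.
rewrite [dary _ _]/= (negPf ts0) => /andP[/andP[gt1 _] /allP dts] fU ES.
(* Inside an original branch [i] the selection is again a transversal, for [f \o cons i]. *)
have SE i x : S (i :: x) = (i < size ts) &&
    (x \in [seq p ++ f (i :: p) | p <- leaves (nth leaf ts i)]).
  rewrite ES; apply/mapP/andP => [[p]|[its /mapP[p pi ->]]].
    rewrite mem_leaves_Node //; case: p => // j p /andP[jts pj] [-> ->].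
    by split=> //; apply: map_f.
  by exists (i :: p); rewrite ?mem_leaves_Node ?its.
rewrite graft_Node // prune_Node size_cat size_map size_nseq iotaD filter_cat.
(* The padding contains no selected leaf. *)
rewrite [seq.filter _ (iota (0 + _) _)](eq_in_filter (a2 := pred0))
  ?filter_pred0 ?cats0; last first.
  move=> j; rewrite mem_iota add0n => /andP[lej _].
  by apply/hasP => -[x _ /=]; rewrite SE ltnNge lej.
(* Every original branch has a leaf of [D], hence a selected leaf below it. *)
rewrite (eq_in_filter (a2 := predT)) ?filter_predT; last first.
  move=> i; rewrite mem_iota add0n /= => its; rewrite nth_graft //.
  have := leaves_neq0 (nth leaf ts i).
  case E: (leaves _) => [//|p s] _; have pi : p \in leaves (nth leaf ts i).
    by rewrite E mem_head.
  apply/hasP; exists (p ++ f (i :: p)).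
    by apply: mem_leaves_graft => //; apply: fU; rewrite mem_leaves_Node // its.
  by rewrite /= SE its /=; apply/mapP; exists p.
rewrite contract_unary_Node ?size_map ?size_iota ?neq_ltn ?gt1 ?orbT //.
rewrite -map_comp.
congr Node; rewrite -[RHS](mkseq_nth leaf); apply/eq_in_map => i.
rewrite mem_iota add0n /= => its; rewrite nth_graft //.
apply: (IH _ (mem_nth leaf its) (f \o cons i)).
- exact/dts/mem_nth.
- by move=> p pi; apply: fU; rewrite mem_leaves_Node // its.
- by move=> x /=; rewrite SE its.
Qed.

(** * Counting copies of [D] in the grafted tree *)

Section Copies.
Variables (d : nat) (U D : tree).
Local Notation LU := (seq_sub (leaves U)).
Local Notation LD := (seq_sub (leaves D)).
Local Notation LT := (seq_sub (leaves (graft d U D))).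

(** Pairs embed as the leaves outside the padding, so leaf sets can be built and counted as subsets
    of a product. *)
Definition graft_leaf (x : LD * LU) : LT :=
  SeqSub (mem_leaves_graft d (ssvalP x.1) (ssvalP x.2)).

Lemma graft_leaf_inj : injective graft_leaf.
Proof.
move=> [p q] [p' q'] /(congr1 val) /= /(leaves_cat_inj (ssvalP p) (ssvalP p')).
by move=> [/val_inj-> /val_inj->].
Qed.

Lemma mem_graft_leaf_imset (G : {set LD * LU}) (x : seq nat) :
  reflect (exists2 y, y \in G & x = val y.1 ++ val y.2)
    (x \in [seq val l | l <- enum (graft_leaf @: G)]).
Proof.
apply: (iffP mapP) => [[l]|[y yG ->]].
  by rewrite mem_enum => /imsetP[y yG ->] ->; exists y.
by exists (graft_leaf y) => //; rewrite mem_enum imset_f.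
Qed.

Definition ffun_graph (f : {ffun LD -> LU}) : {set LD * LU} :=
  [set (p, f p) | p : LD]%SET.

Lemma ffun_graph_inj : injective ffun_graph.
Proof.
move=> f g fg; apply/ffunP => p.
have : (p, f p) \in ffun_graph g by rewrite -fg imset_f.
by case/imsetP => _ _ [<- ->].
Qed.

Lemma card_leaf_type t : #|{: seq_sub (leaves t)}| = nleaves t.
Proof. by rewrite card_seq_sub // uniq_leaves. Qed.

Definition copy_sets T : {set {set seq_sub (leaves T)}} :=
  [set S : {set seq_sub (leaves T)} | 
     (#|S| == nleaves D) && tree_iso (Defs.induced S) D]%SET.

Lemma transversal_copy f : dary d D ->
  graft_leaf @: ffun_graph f \in copy_sets (graft d U D).
Proof.
move=> dD; rewrite inE card_imset; last exact: graft_leaf_inj.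
rewrite card_imset ?card_leaf_type ?eqxx; last by move=> p q [].
(* [g] extends [f] to all addresses; the default [[::]] is never read at a leaf of [D]. *)
rewrite inducedE /=; pose g p := oapp (fun p' => val (f p')) [::] (insub p).
have gE (p : LD) : g (val p) = val (f p) by rewrite /g valK.
rewrite (@contract_prune_transversal d U D g) ?tree_iso_refl //.
  by move=> p pD; rewrite (gE (SeqSub pD)) ssvalP.
move=> x; apply/mem_graft_leaf_imset/mapP => [[_ /imsetP[p _ ->] ->]|[p pD ->]].
  by exists (val p); rewrite ?gE ?ssvalP.
by exists (SeqSub pD, f (SeqSub pD)); rewrite ?imset_f // -gE.
Qed.

Lemma induced_below p (S : {set LU}) : S != finset.set0 ->
  Defs.induced (graft_leaf @: finset.setX [set p]%SET S) = Defs.induced S.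
Proof.
move=> /set0Pn[q0 q0S]; rewrite !inducedE.
have H x :
   (x \in [seq val l | l <- enum (graft_leaf @: finset.setX [set p]%SET S)])
   <-> exists2 q, q \in S & x = val p ++ val q.
  split=> [/mem_graft_leaf_imset[[p' q]]|[q qS ->]].
    by rewrite finset.in_setX inE /= => /andP[/eqP-> qS] ->; exists q.
  apply/mem_graft_leaf_imset; exists (p, q) => //.
  by rewrite finset.in_setX inE eqxx.
rewrite (contract_prune_below _ (ssvalP p)); first last.
- apply/hasP; exists (val q0); first exact: ssvalP.
  by apply/H; exists q0.
- by move=> x /H[q _ ->]; exists (val q).
congr (contract_unary (prune _ U)); apply/funext => x /=.
apply/idP/mapP => [/H[q qS /eqP]|[q]].
  by rewrite eqseq_cat // eqxx => /eqP->; exists q; rewrite ?mem_enum.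
by rewrite mem_enum => qS ->; apply/H; exists q.
Qed.

(** [A] consists of the transversals, [B] of the copies of [D] inside one copy of [U]. They are
    disjoint because a transversal meets all [k >= 2] copies of [U]. *)
Lemma copies_graft : dary d D -> 2 <= nleaves D ->
  nleaves U ^ nleaves D + nleaves D * copies D U <= copies D (graft d U D).
Proof.
move=> dD D2.
pose A := [set ffun_graph f | f : {ffun LD -> LU}]%SET.
pose B := [set finset.setX [set z.1]%SET z.2 |
  z in finset.setX [set: LD]%SET (copy_sets U)]%SET.
(* Nonemptiness of [S] lets the product of [[set p]] and [S] determine [p]. *)
have copy_neq0 S : S \in copy_sets U -> S != finset.set0.
  by rewrite inE => /andP[/eqP cS _]; rewrite -card_gt0 cS ltnW.
have cA : #|A| = nleaves U ^ nleaves D.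
  rewrite card_imset; last exact: ffun_graph_inj.
  by rewrite card_ffun !card_leaf_type.
have cB : #|B| = nleaves D * copies D U.
  rewrite card_in_imset.
    by rewrite cardsX cardsT card_leaf_type.
  move=> [p S] [p' S'].
  rewrite !finset.in_setX !inE /= => cS cS' /finset.setP E.
  have /set0Pn[q qS] : S != finset.set0 by apply: copy_neq0; rewrite inE.
  have /eqP pp' : p == p'.
    have := E (p, q).
    by rewrite !finset.in_setX !inE /= eqxx qS => /esym/andP[].
  rewrite -pp' in E *; congr pair; apply/finset.setP => x.
  by have := E (p, x); rewrite !finset.in_setX !inE /= eqxx.
have AB0 : A :&: B = finset.set0.
  apply/finset.setP => G; rewrite finset.in_set0; apply/negP.
  move=> /setIP[/imsetP[f _ ->]].
  move=> /imsetP[[p S] _ /= /finset.setP E].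
  have : #|[set p]%SET| < #|{: LD}| by rewrite cards1 card_leaf_type.
  rewrite ltnNge => /negP; apply; apply/subset_leq_card/fintype.subsetP => p' _.
  by have := E (p', f p'); rewrite imset_f // finset.in_setX => /esym/andP[].
(* By disjointness [#|A| + #|B|] is the cardinal of the union, which the injective [graft_leaf]
   preserves. *)
rewrite -cA -cB -[X in X <= _]subn0 -[X in _ - X](cards0 {set LD * LU}%type).
rewrite -AB0 -cardsU -(card_imset _ (imset_inj graft_leaf_inj)).
apply/subset_leq_card/fintype.subsetP => _ /imsetP[G /setUP GAB ->].
case: GAB => /imsetP[]; first by move=> f _ ->; apply: transversal_copy.
move=> [p S]; rewrite finset.in_setX => /andP[_ /=] cS ->.
have := cS; rewrite !inE induced_below ?copy_neq0 // => /andP[/eqP cSD ->].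
rewrite card_imset ?cardsX ?cards1 ?mul1n ?cSD ?eqxx //.
exact: graft_leaf_inj.
Qed.

End Copies.

(** * Asymptotics of the recurrence *)

Local Open Scope ring_scope.

(** Bernoulli's inequality in homogeneous form: [m - b] times the bound for [K] exceeds the bound
    for [K.+1] by [K.+1 * b ^ 2 * m ^ K]. *)
Lemma exprB_ge_linear (R : realDomainType) (b m : R) (K : nat) :
  0 <= b <= m -> m ^+ K.+1 - K.+1%:R * b * m ^+ K <= (m - b) ^+ K.+1.
Proof.
move=> /andP[b0 bm]; have m0 : 0 <= m := le_trans b0 bm.
elim: K => [|K IHK]; first by rewrite !expr1 expr0 mul1r mulr1.
rewrite [X in _ <= X]exprS.
apply: le_trans (ler_wpM2l _ IHK); last by rewrite subr_ge0.
rewrite -subr_ge0 [m ^+ K.+2]exprS [m ^+ K.+1]exprS -[K.+2]addn1 natrD.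
rewrite [X in 0 <= X](_ : _ = K.+1%:R * b ^+ 2 * m ^+ K); last by ring.
by rewrite !mulr_ge0 ?exprn_ge0.
Qed.

Section Recurrence.
Variables (R : realFieldType) (K e : nat) (n c : nat -> nat).
Local Notation k := K.+1.
Hypotheses (K_gt0 : (0 < K)%N) (n0 : n 0 = 1%N).
Hypothesis nS : forall j, n j.+1 = (k * n j + e)%N.
Hypothesis cS : forall j, (n j ^ k + k * c j <= c j.+1)%N.

(* [b] makes [n j + b] geometric; the term [beta * j.+1] of [c_ge] below
   collects the errors made in replacing [n j] by [n j + b].                  *)
Let b : R := e%:R / K%:R.
Let a : R := 1 + b.
Let m j : R := a * k%:R ^+ j.
Let alpha : R := (k%:R ^+ k - k%:R)^-1.
Let beta : R := b + alpha * a.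

Let K_neq0 : K%:R != 0 :> R. Proof. by rewrite pnatr_eq0 -lt0n. Qed.
Let b_ge0 : 0 <= b. Proof. by rewrite divr_ge0. Qed.
Let a_ge1 : 1 <= a. Proof. by rewrite lerDl. Qed.

Let k_ge1 : 1 <= k%:R :> R. Proof. by rewrite ler1n. Qed.

Let k_lt_pow : k%:R < k%:R ^+ k :> R.
Proof. by rewrite -natrX ltr_nat -[X in (X < _)%N]expn1 ltn_exp2l. Qed.

Let alpha_gt0 : 0 < alpha. Proof. by rewrite invr_gt0 subr_gt0. Qed.

Let beta_ge0 : 0 <= beta.
Proof. by rewrite addr_ge0 // mulr_ge0 ?(ltW alpha_gt0) ?(le_trans ler01). Qed.

Let nE j : (n j)%:R = m j - b.
Proof.
rewrite /m; elim: j => [|j IHj]; first by rewrite n0 expr0 mulr1 /a addrK.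
rewrite nS natrD natrM IHj exprS /a /b -natr1.
by field; rewrite K_neq0.
Qed.

Let m_ge_a j : a <= m j.
Proof. by rewrite ler_peMr ?(le_trans ler01) // exprn_ege1. Qed.

Let m_gt0 j : 0 < m j.
Proof. exact: lt_le_trans ltr01 (le_trans a_ge1 (m_ge_a j)). Qed.

Let b_le_m j : b <= m j.
Proof. by apply: le_trans (m_ge_a j); rewrite lerDr. Qed.

Let mS j : m j.+1 = k%:R * m j.
Proof. by rewrite /m exprS; ring. Qed.

Let c_ge j : alpha * m j ^+ k - beta * j.+1%:R * m j ^+ K <= (c j)%:R.
Proof.
elim: j => [|j IHj].
  have m0 : m 0 = a by rewrite /m expr0 mulr1.
  (* The summand [alpha * a] of [beta] makes the left side nonpositive at [j = 0]. *)
  rewrite exprS mulr1 mulrA -mulrBl m0.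
  apply: le_trans (ler0n _ _).
  rewrite mulr_le0_ge0 ?exprn_ge0 ?(le_trans ler01) //.
  by rewrite subr_le0 /beta lerDr.
have := cS j; rewrite -(ler_nat R) natrD natrX natrM nE => /(le_trans _); apply.
have := exprB_ge_linear K (introT andP (conj b_ge0 (b_le_m j))).
move/(fun H => le_trans _ (lerD H (ler_wpM2l (ler0n _ k) IHj))); apply.
rewrite mS [X in alpha * X]exprMn [(_ * m j) ^+ K]exprMn.
(* This equation cancels the leading terms. What remains is a multiple of [m j ^ K], nonnegative
   because [k <= k ^ K] and [b <= beta]. *)
have alphaE : alpha * k%:R ^+ k = 1 + k%:R * alpha.
  rewrite /alpha -[X in X = _](subrK (alpha * k%:R)) -mulrBr mulVf.
    by rewrite mulrC.
  by rewrite subr_eq0 gt_eqF.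
rewrite [alpha * _]mulrA alphaE -subr_ge0.
set M := m j ^+ K; have M0 : 0 <= M by rewrite exprn_ge0 // ltW.
have kK : k%:R <= k%:R ^+ K :> R by rewrite -[X in X <= _]expr1 ler_weXn2l.
rewrite [X in 0 <= X](_ : _ = (beta * j.+2%:R * k%:R ^+ K - k%:R * b
   - k%:R * beta * j.+1%:R) * M); last by rewrite [m j ^+ k]exprS -/M; ring.
rewrite mulr_ge0 // -[j.+2%:R]natr1.
have H : beta * (j.+1%:R + 1) * k%:R <= beta * (j.+1%:R + 1) * k%:R ^+ K.
  by rewrite ler_wpM2l // mulr_ge0 // addr_ge0.
have H' : b * k%:R <= beta * k%:R.
  by rewrite ler_wpM2r // lerDl mulr_ge0 ?(ltW alpha_gt0) ?(le_trans ler01).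
lra.
Qed.

(* Only even indices are used: [j.+1 / k ^ j] then has an elementary bound. *)
Lemma recurrence_ratio_ge : exists2 C : R, 0 <= C & forall i,
  (k%:R ^+ k - k%:R)^-1 - C / i.+1%:R <= (c i.*2)%:R / (n i.*2)%:R ^+ k.
Proof.
exists (2 * beta) => [|i]; first by rewrite mulr_ge0.
set j := i.*2; have n_gt0 : 0 < (n j)%:R :> R.
  rewrite ltr0n; elim: (j) => [|j' IH]; first by rewrite n0.
  by rewrite nS addn_gt0 muln_gt0 IH.
have nm : (n j)%:R <= m j by rewrite nE gerBl.
(* As [n j <= m j], the denominator may be enlarged; the error then becomes [beta * j.+1 / m j],
   with [m j >= k ^ j]. *)
apply: (@le_trans _ _ ((c j)%:R / m j ^+ k)); last first.
  rewrite ler_wpM2l // lef_pV2 ?posrE ?exprn_gt0 //.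
  by rewrite lerXn2r ?nnegrE ?(ltW n_gt0) ?(ltW (m_gt0 j)).
rewrite ler_pdivlMr ?exprn_gt0 //; apply: le_trans (c_ge j).
rewrite -/alpha mulrBl lerD2l lerN2 [m j ^+ k]exprS mulrA.
rewrite ler_wpM2r ?exprn_ge0 ?(ltW (m_gt0 j)) //.
rewrite mulrAC ler_pdivlMr // -!mulrA [2 * _]mulrCA; apply: ler_wpM2l => //.
(* Here [j.+1 <= 2 * i.+1], and [i.+1 <= k ^ i] used twice bounds [i.+1 ^ 2] by [k ^ j]. *)
apply: (@le_trans _ _ (2 * (i.+1%:R * i.+1%:R))).
  by rewrite -!natrM ler_nat /j -addnn; nia.
rewrite ler_wpM2l //; apply: le_trans (_ : k%:R ^+ j <= _); last first.
  by rewrite ler_peMl // exprn_ge0.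
rewrite -natrM -natrX ler_nat /j -addnn expnD.
by apply: leq_mul; apply: ltn_expl.
Qed.

End Recurrence.

(** * Densities in the iterated grafts *)

Lemma bin_fact_le_exp (n k : nat) : ('C(n, k) * k`! <= n ^ k)%N.
Proof.
rewrite bin_ffact ffact_prod -[k in (n ^ k)%N]card_ord -prod_nat_const.
by apply: leq_prod => i _; apply: leq_subr.
Qed.

Section IteratedGraft.
Variables (d : nat) (D : tree).
Hypotheses (D_dary : dary d D) (D_ge2 : (2 <= nleaves D)%N).

Definition iter_graft j : tree := iter j (fun U => graft d U D) leaf.

Lemma strictly_dary_iter_graft j : strictly_dary d (iter_graft j).
Proof. by elim: j => //= j IHj; apply: strictly_dary_graft. Qed.

Lemma nleaves_iter_graft_gt j : (j < nleaves (iter_graft j))%N.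
Proof.
elim: j => //= j IHj; rewrite nleaves_graft ltn_addr //.
apply: leq_trans (leq_mul D_ge2 (leqnn _)).
by rewrite mul2n -addnn -addn1 leq_add // (leq_trans _ IHj).
Qed.

(** Since ['C(n, k) <= n ^ k / k!], the density is at least [k! * c / n ^ k]; moreover [k! / (k ^ k
    - k) = (k-1)! / (k ^ (k-1) - 1)]. *)
Lemma density_iter_graft_ge (R : realType) : exists2 C : R, 0 <= C &
  forall i, (nleaves D <= i.*2)%N ->
    (nleaves D).-1`!%:R / ((nleaves D)%:R ^+ (nleaves D).-1 - 1) - C / i.+1%:R
    <= density R D (iter_graft i.*2).
Proof.
have kE : (nleaves D).-1.+1 = nleaves D by rewrite prednK // ltnW.
set K := (nleaves D).-1 in kE *.
have K_gt0 : (0 < K)%N by rewrite -ltnS kE.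
have nS j : nleaves (iter_graft j.+1) =
    (K.+1 * nleaves (iter_graft j) + missing_children d D)%N.
  by rewrite kE /= nleaves_graft.
have cS j : (nleaves (iter_graft j) ^ K.+1 + K.+1 * copies D (iter_graft j)
    <= copies D (iter_graft j.+1))%N.
  by rewrite kE; apply: copies_graft.
have n0 : nleaves (iter_graft 0) = 1%N by [].
have [C C0 ratio] := recurrence_ratio_ge R K_gt0 n0 nS cS.
exists (K.+1`!%:R * C) => [|i ki]; first by rewrite mulr_ge0.
set T := iter_graft _; have kT : (nleaves D <= nleaves T)%N.
  by apply: leq_trans ki (ltnW (nleaves_iter_graft_gt _)).
have bin_gt0 : 0 < 'C(nleaves T, nleaves D)%:R :> R by rewrite ltr0n bin_gt0.
apply: (@le_trans _ _ (K.+1`!%:R * ((copies D T)%:R / (nleaves T)%:R ^+ K.+1))).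
  apply: le_trans (ler_wpM2l _ (ratio i)); last by [].
  rewrite mulrBr mulrA lerD2r -kE factS natrM exprS.
  rewrite -[X in (_ * _ - X)^-1]mulr1 -mulrBr.
  by rewrite invfM mulrACA divff ?mul1r // pnatr_eq0.
rewrite kE mulrCA /density ler_wpM2l // -[X in X <= _]invf_div.
rewrite lef_pV2 ?posrE //.
  rewrite ler_pdivlMr ?ltr0n ?fact_gt0 // -natrM -natrX ler_nat.
  exact: bin_fact_le_exp.
rewrite divr_gt0 ?ltr0n ?fact_gt0 // exprn_gt0 // ltr0n.
exact: leq_trans (nleaves_iter_graft_gt _).
Qed.

End IteratedGraft.

(** * Passage to the limit superior *)

Theorem proposition8 (R : realType) (d : nat) (D : tree) :
  (2 <= d)%N -> dary d D -> (2 <= nleaves D)%N ->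
  ((((nleaves D).-1)`!%:R / ((nleaves D)%:R ^+ (nleaves D).-1 - 1) : R)%:E
     <= inducibility R d D)%E
  /\ (0 < inducibility R d D)%E.
Proof.
move=> d2 dD D2; set L := (_ / _)%R.
have L_gt0 : (0 < L)%R.
  rewrite divr_gt0 ?ltr0n ?fact_gt0 // subr_gt0 exprn_egt1 ?ltr1n //.
  by rewrite -lt0n -ltnS prednK // ltnW.
suff leL : (L%:E <= inducibility R d D)%E.
  by split=> //; apply: lt_le_trans leL; rewrite lte_fin.
(* The limit superior is an infimum over the sets [V] of the filter, and [V] contains every [n >= N]
   congruent to 1 modulo [d - 1]. It suffices to find, for each [eps], a tree of density at least
   [L - eps] with its number of leaves in [V]. *)
apply: le_ereal_inf_tmp => _ [V [N _ NV] <-].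
have [C C0 dens] := density_iter_graft_ge dD D2 R.
apply/lee_addgt0Pr => eps eps0.
(* The three bounds put [nleaves T] beyond [N], make [D] fit into [T], and bring the error
   [C / i.+1] down to [eps]. *)
pose i := maxn (maxn N (nleaves D)) (Num.bound (C / eps)).
have [Ni ki bi] : [/\ N <= i, nleaves D <= i & Num.bound (C / eps) <= i]%N.
  by rewrite /i !leq_max !leqnn !orbT.
have ii : (i <= i.*2)%N by rewrite -addnn leq_addr.
pose T := iter_graft d D i.*2.
have sT : strictly_dary d T := strictly_dary_iter_graft dD _.
have VT : V (nleaves T).
  apply: NV; last exact: nleaves_strictly_dary_mod sT.
  exact: leq_trans Ni (leq_trans ii (ltnW (nleaves_iter_graft_gt d D2 _))).
have CE : (C / i.+1%:R <= eps)%R.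
  rewrite ler_pdivrMr // mulrC -ler_pdivrMr //.
  apply: le_trans (ltW (archi_boundP _)) _; first by rewrite divr_ge0 // ltW.
  by rewrite ler_nat ltnW.
have densT : ((density R D T)%:E <= ereal_sup (max_density R d D @` V))%E.
  apply: (@le_trans _ _ (max_density R d D (nleaves T))).
    by apply: ereal_sup_ubound; exists T.
  by apply: ereal_sup_ubound; exists (nleaves T).
apply: le_trans (leeD2r eps%:E densT).
rewrite -EFinD lee_fin -lerBlDr; apply: le_trans (dens i _).
  by rewrite lerD2l lerN2.
exact: leq_trans ki ii.
Qed.
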